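(* For every real number $a$ that is not an integer multiple of $\pi$, $$\frac{\sin(a)}{a}=\prod_{j=1}^{\infty}\left(\frac{a}{2^{j}}\cot\!\left(\frac{a}{2^{j}}\right)\right)^{2^{j-1}} ;$$ equivalently, $$\prod_{j=1}^{\infty}\left(\frac{2^{j}}{a}\tan\!\left(\frac{a}{2^{j}}\right)\right)^{2^{j-1}}=\frac{a}{\sin(a)} .$$
   Context: An infinite product $\prod_{j=1}^{\infty}c_j$ means $\lim_{M\to\infty}\prod_{j=1}^{M}c_j$. *)

(* Defs.v *)
From HB Require Import structures.
From mathcomp Require Import all_boot all_order all_algebra.
From mathcomp Require Import all_classical all_reals all_analysis.

Set Implicit Arguments.
Unset Strict Implicit.
Unset Printing Implicit Defensive.

Import Order.TTheory GRing.Theory Num.Theory.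
Import numFieldNormedType.Exports.

Local Open Scope classical_set_scope.
Local Open Scope ring_scope.

Definition cot (R : realType) (x : R) : R := cos x / sin x.

(* The product over j >= 1 converges to l. The value c 0 is not used, and
   l = 0 is not treated as divergence. *)
Definition infprod_eq (R : realType) (c : nat -> R) (l : R) : Prop :=
  \prod_(1 <= j < M.+1) c j @[M --> \oo] --> l.

(* Main.v *)
Require Import Defs.
From HB Require Import structures.
From mathcomp Require Import all_boot all_order all_algebra.
From mathcomp Require Import all_classical all_reals all_analysis.
From mathcomp Require Import ring lra.

Set Implicit Arguments.
Unset Strict Implicit.
Unset Printing Implicit Defensive.

Import Order.TTheory GRing.Theory Num.Theory.
Import numFieldNormedType.Exports.

Local Open Scope classical_set_scope.
Local Open Scope ring_scope.

(** Write [s x = sin x / x]. The duplication formula for [sin] gives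
    [x * cot x = s (2 * x) / s x ^ 2], so with [x = a / 2 ^ j] the [j]-th factor
    is [s (a / 2 ^ (j - 1)) ^ (2 ^ (j - 1)) / s (a / 2 ^ j) ^ (2 ^ j)] and the
    product telescopes to [s a / s (a / 2 ^ M) ^ (2 ^ M)]. Since
    [s x = 1 + O(x ^ 2)], the denominator is [1 + O(2 ^ M / 4 ^ M)]. The factors
    of the second product are the inverses of those of the first. *)

Lemma norm_sinDzpi (R : realType) (x : R) (k : int) :
  `|sin (x + k%:~R * pi)| = `|sin x|.
Proof.
have normD n y : `|sin (y + pi *+ n)| = `|sin y| :> R.
  by rewrite (alternatingn (@sinDpi R)) normrM normrX normrN1 expr1n mul1r.
case: k => n; rewrite ?NegzE ?mulrNz -?pmulrn.
  by rewrite mulr_natl normD.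
by rewrite -[in RHS](subrK (n.+1%:R * pi) x) mulr_natl normD mulNr mulr_natl.
Qed.

(** Subtracting [k * pi] with [k] the floor of [a / pi] moves [a] into [[0, pi)]; [ha] excludes the
    endpoint 0, and [sin] is positive on the open interval. *)
Lemma sin_neq0 (R : realType) (a : R) :
  (forall k : int, a <> k%:~R * pi) -> sin a != 0.
Proof.
move=> ha; have pi0 := @pi_gt0 R; set k := Num.floor (a / pi).
have /andP[ka ak] := floor_itv (a / pi).
have aE : a = (a - k%:~R * pi) + k%:~R * pi by rewrite subrK.
rewrite -normr_eq0 aE norm_sinDzpi normr_eq0 gt_eqF// sin_gt0_pi//.
move: ka ak; rewrite ler_pdivlMr// ltr_pdivrMr// -/k => ka ak.
rewrite subr_gt0 ltrBlDl -[X in _ + X]mul1r -mulrDl -intrD1 ak andbT.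
by rewrite lt_neqAle ka andbT eq_sym; apply/eqP/ha.
Qed.

(** The mean value theorem on [[0, x]], carried to negative [x] by oddness. The bound on [c] lets
    estimates of [cos c] be stated in terms of [x]. *)
Lemma sin_mean_value (R : realType) (x : R) :
  exists2 c, `|c| <= `|x| & sin x = cos c * x.
Proof.
wlog x0 : x / 0 <= x => [wlg|].
  case: (leP 0 x) => [/wlg//|/ltW]; rewrite -oppr_ge0 => /wlg[c cx sx].
  by exists c; rewrite -?(normrN x)// -[LHS]opprK -sinN sx mulrN opprK.
have sinC : {within `[0, x], continuous (@sin R)}.
  exact/continuous_subspaceT/continuous_sin.
have [c] := MVT_segment x0 (fun y _ => is_derive_sin y) sinC.
rewrite in_itv/= sin0 !subr0 => /andP[c0 cx] sx.
by exists c; rewrite ?ger0_norm// (le_trans c0).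
Qed.

Lemma norm_sin_le (R : realType) (x : R) : `|sin x| <= `|x|.
Proof.
by have [c _ ->] := sin_mean_value x; rewrite normrM ler_piMl// cos_max.
Qed.

Lemma cos_ge_quadratic (R : realType) (x : R) : 1 - x ^+ 2 / 2 <= cos x.
Proof.
(* The half-angle form turns the linear bound on [sin] into a quadratic one on [cos]. *)
have -> : cos x = 1 - sin (x / 2) ^+ 2 *+ 2.
  have xE : x = (x / 2) *+ 2 by rewrite -mulr_natr divfK.
  by rewrite {1}xE cos_mulr2n cos2sin2; ring.
have : sin (x / 2) ^+ 2 <= (x / 2) ^+ 2.
  by rewrite -[leLHS]real_normK ?num_real// -[leRHS]real_normK ?num_real//
    lerXn2r ?nnegrE ?norm_sin_le.
by rewrite exprMn; lra.
Qed.

Lemma norm_sinc_le1 (R : realType) (x : R) : `|sin x / x| <= 1.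
Proof.
have [->|x0] := eqVneq x 0; first by rewrite invr0 mulr0 normr0.
by rewrite normrM normfV ler_pdivrMr ?normr_gt0// mul1r norm_sin_le.
Qed.

Lemma norm_sincB1 (R : realType) (x : R) : x != 0 ->
  `|sin x / x - 1| <= x ^+ 2 / 2.
Proof.
move=> x0; have [c cx ->] := sin_mean_value x; rewrite mulfK//.
have : c ^+ 2 <= x ^+ 2.
  by rewrite -[leLHS]real_normK ?num_real// -[leRHS]real_normK ?num_real//
    lerXn2r ?nnegrE.
have := cos_ge_quadratic c; have := cos_le1 c.
by rewrite ler_norml => *; lra.
Qed.

(** Inside the unit ball the error grows only linearly in the exponent, since multiplying by [x]
    does not enlarge the error already made. *)
Lemma norm_exprB1 (R : numDomainType) (x : R) (n : nat) : `|x| <= 1 ->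
  `|x ^+ n - 1| <= `|x - 1| *+ n.
Proof.
move=> x1; elim: n => [|n IHn]; first by rewrite expr0 subrr normr0 mulr0n.
have -> : x ^+ n.+1 - 1 = x * (x ^+ n - 1) + (x - 1).
  by rewrite mulrBr mulr1 -exprS addrA subrK.
by rewrite mulrSr (le_trans (ler_normD _ _))// lerD2r normrM
  (le_trans (ler_piMl _ x1)).
Qed.

Lemma cvg_sinc_pow (R : realType) (a : R) : a != 0 ->
  (sin (a / 2 ^+ M) / (a / 2 ^+ M)) ^+ (2 ^ M)%N @[M --> \oo] --> (1 : R).
Proof.
move=> a0; apply/subr_cvg0/norm_cvg0P.
have bound M : 0 <= `|(sin (a / 2 ^+ M) / (a / 2 ^+ M)) ^+ (2 ^ M)%N - 1|
    <= geometric (a ^+ 2 / 2) 2^-1 M.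
  rewrite normr_ge0 (le_trans (norm_exprB1 _ (norm_sinc_le1 _)))//=.
  have p0 : 2 ^+ M != 0 :> R by rewrite expf_neq0.
  (* The [2 ^ M] copies of an error of order [4 ^ - M] add up to a geometric term of ratio 1/2. *)
  have -> : a ^+ 2 / 2 * 2^-1 ^+ M = ((a / 2 ^+ M) ^+ 2 / 2) *+ (2 ^ M).
    by rewrite -[RHS]mulr_natr natrX exprVn; field.
  by rewrite lerMn2r norm_sincB1 ?orbT// mulf_neq0 ?invr_eq0.
apply: (squeeze_cvgr (h := geometric (a ^+ 2 / 2) 2^-1)).
- by apply: nearW => M; exact: bound.
- exact: cvg_cst.
- by apply: cvg_geometric; rewrite ger0_norm; lra.
Qed.

Lemma mulr_cot (R : realType) (x : R) : x != 0 -> sin x != 0 ->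
  x * cot x = (sin (x *+ 2) / (x *+ 2)) / (sin x / x) ^+ 2.
Proof.
by move=> x0 s0; rewrite /cot sin_mulr2n; field; rewrite x0 s0.
Qed.

(** By the duplication formula, a zero of [sin] at [a / 2 ^ (j + 1)] would force one at [a / 2 ^ j],
    and so on up to [a]. *)
Lemma sin_divX2_neq0 (R : realType) (a : R) (j : nat) :
  sin a != 0 -> sin (a / 2 ^+ j) != 0.
Proof.
move=> sa; elim: j => [|j]; first by rewrite expr0 divr1.
have -> : a / 2 ^+ j = (a / 2 ^+ j.+1) *+ 2.
  by rewrite -mulr_natr exprSr; field; rewrite expf_neq0.
by rewrite sin_mulr2n; apply: contra_neq => ->; rewrite mulr0 mul0rn.
Qed.

Lemma prod_mulr_cot (R : realType) (a : R) (M : nat) : a != 0 -> sin a != 0 ->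
  \prod_(1 <= j < M.+1) (a / 2 ^+ j * cot (a / 2 ^+ j)) ^+ (2 ^ (j - 1))%N
  = (sin a / a) / (sin (a / 2 ^+ M) / (a / 2 ^+ M)) ^+ (2 ^ M)%N.
Proof.
move=> a0 sa.
have x0 j : a / 2 ^+ j != 0 by rewrite mulf_neq0 ?invr_eq0 ?expf_neq0.
have s0 j : sin (a / 2 ^+ j) / (a / 2 ^+ j) != 0.
  by rewrite mulf_neq0 ?invr_eq0// sin_divX2_neq0.
elim: M => [|M IHM].
  by rewrite big_geq// expr0 divr1 expn0 expr1 divff// -[a]divr1 -(expr0 2).
rewrite big_nat_recr//= IHM subn1/= mulr_cot ?sin_divX2_neq0//.
have -> : (a / 2 ^+ M.+1) *+ 2 = a / 2 ^+ M.
  by rewrite -mulr_natr exprSr; field; rewrite expf_neq0.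
(* The numerator of the new factor, raised to [2 ^ M], cancels the denominator from [IHM]; its
   squared denominator gets the exponent [2 ^ (M + 1)]. *)
by rewrite [(_ / _ ^+ 2) ^+ _]expr_div_n -exprM -expnS mulrA divfK// expf_neq0.
Qed.

Theorem mainTheorem1 (R : realType) (a : R)
    (ha : forall k : int, a <> k%:~R * pi) :
  infprod_eq (fun j : nat => (a / 2 ^+ j * cot (a / 2 ^+ j)) ^+ (2 ^ (j - 1))%N)
             (sin a / a)
  /\
  infprod_eq (fun j : nat => (2 ^+ j / a * tan (a / 2 ^+ j)) ^+ (2 ^ (j - 1))%N)
             (a / sin a).
Proof.
have a0 : a != 0 by apply/eqP; rewrite -[0](mul0r pi); exact: (ha 0).
have sa := sin_neq0 ha.
have cotP : infprod_eq
    (fun j : nat => (a / 2 ^+ j * cot (a / 2 ^+ j)) ^+ (2 ^ (j - 1))%N)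
    (sin a / a).
  rewrite /infprod_eq -[X in _ --> X]divr1.
  under eq_fun do rewrite prod_mulr_cot//.
  apply: cvgM; first exact: cvg_cst.
  by apply: cvgV; [exact: oner_neq0|exact: cvg_sinc_pow].
split=> //; rewrite /infprod_eq -invf_div.
(* Since [0^-1 = 0], inverting the quotients and powers takes no case analysis on the cosines; only
   the limit [sin a / a] has to be nonzero. *)
under eq_fun => M.
  under eq_bigr => j _ do
    rewrite /tan -invf_div -[sin _ / cos _]invf_div -invfM exprVn.
  rewrite prodfV.
  over.
by apply: cvgV; [rewrite mulf_neq0 ?invr_eq0|exact: cotP].
Qed.
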